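(* Let $\phi=(f_n)_{n\ge0}\in\Gamma(\mathcal N_{a,1})$. Then $\phi$, identified with $i(\phi)=(i(f_n))_{n\ge0}$, is included in $\Gamma(E_{-q})$ for some $q\in\mathbb N$.
   Context: Let $\{e_k\}_{k\ge1}$ be an orthonormal basis of a complex Hilbert space $H$, and let $1<\lambda_1\le\lambda_2\le\cdots$ be reals with $\sum_k\lambda_k^{-2}<\infty$. For $r\in\mathbb R$ and $\xi=\sum_k\alpha_ke_k$ put $|\xi|_r^2=\sum_k\lambda_k^{2r}|\alpha_k|^2$. For $r\ge0$ let $E_r=\{\xi\in H:|\xi|_r<\infty\}$ and let $E_{-r}$ be the completion of $H$ for $|\cdot|_{-r}$. Let $E=\bigcap_{r\ge0}E_r$ (projective limit) with dual $E^*=\bigcup_{r\ge0}E_{-r}$ (inductive limit); $\langle\cdot,\cdot\rangle$ denotes the canonical bilinear pairing of $E^*$ with $E$. For a Hilbert space $K$, the Fock space $\Gamma(K)$ is the set of sequences $\phi=(f_n)_{n\ge0}$ with $f_n\in K^{\hat\otimes n}$ (symmetric Hilbert space tensor power, $K^{\hat\otimes0}=\mathbb C$) and $\sum_{n\ge0}n!\,|f_n|^2_{K^{\hat\otimes n}}<\infty$. Fix $a\in(1/2,\infty)$ and a sequence $\{e_{a,k}\}_{k\ge1}\subset E^*$ such that: (C1) for all $k_1,k_2$, $\lim_{N\to\infty}\frac1{N^{2a-1}}\sum_{j=1}^N\overline{\langle e_{a,k_1},e_j\rangle}\langle e_{a,k_2},e_j\rangle$ equals $1$ if $k_1=k_2$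 and $0$ otherwise; (C2) there are $p>0$ and $M>0$ with $|e_{a,k}|_{-p}\le M$ for all $k$ (such $p,M$ are fixed); (C3) for every $\alpha=\{\alpha_k\}\in\ell^1$ with $\alpha\ne0$, $\sum_k\alpha_ke_{a,k}\neq0$, the sum being taken in $E^*$. Let $H_{c,2a-1}$ be the Hilbert space with orthonormal basis $\{e_{a,k}\}_{k\ge1}$, with inner product $\langle\cdot,\cdot\rangle_{c,2a-1}$ conjugate-linear in the first variable. Let $1<\lambda_{a,1}\le\lambda_{a,2}\le\cdots$ be reals with $\sum_k\lambda_{a,k}^{-2}<\infty$. For $r\ge0$ let $\mathcal N_{a,r}$ be the Hilbert space of all $\sum_k\alpha_ke_{a,k}\in H_{c,2a-1}$ with $\sum_k\lambda_{a,k}^{2r}|\alpha_k|^2<\infty$, with the corresponding norm. For $f_n\in\mathcal N_{a,1}^{\otimes n}$ put $b_{k_1,\dots,k_n}=\langle e_{a,k_1}\otimes\cdots\otimes e_{a,k_n},f_n\rangle_{c,2a-1}$ (inner product of $H_{c,2a-1}^{\otimes n}$). Then $\{b_{k_1,\dots,k_n}\}\in\ell^1(\mathbb N^n)$, and the inclusion map $i:\mathcal N_{a,1}^{\otimes n}\to E_{-p}^{\otimes n}$ is $$i(f_n)=\sum_{k_1,\dots,k_n=1}^\infty b_{k_1,\dots,k_n}\,e_{a,k_1}\otimes\cdots\otimes e_{a,k_n},$$ the series being taken in $E_{-p}^{\otimes n}$; for $n=0$, $i$ is the identity of $\mathbb C$. One has $E_{-r}\subset E_{-s}$ for $0\le r\le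 s$, and likewise for tensor powers. *)

(* Defs.v *)
From HB Require Import structures.
From mathcomp Require Import all_boot all_order all_algebra all_fingroup.
From mathcomp Require Import all_classical all_reals all_analysis.
From mathcomp Require Import complex.
Set Implicit Arguments.
Unset Strict Implicit.
Unset Printing Implicit Defensive.
Import Order.TTheory GRing.Theory Num.Theory numFieldNormedType.Exports.
Local Open Scope classical_set_scope.
Local Open Scope ring_scope.
Local Open Scope complex_scope.

(* All sequences are indexed from 0: the basis vector e_(k+1) is [e k]. *)

(* Complex Hilbert spaces; the inner product is conjugate-linear in its first
   variable. *)
Record hilbert (R : realType) := Hilbert {
  hsort :> completeNormedModType R[i] ;
  hdot : hsort -> hsort -> R[i] ;
  hdot_linear : forall x : hsort, scalar (hdot x) ;
  hdotC : forall x y : hsort, hdot y x = (hdot x y)^* ;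
  hdotxx : forall x : hsort, hdot x x = `|x| ^+ 2
}.

(* The norm of a normed space over R[i] takes its values in R[i]; this is its
   value in R. *)
Definition rnorm (R : realType) (V : normedModType R[i]) (x : V) : R :=
  complex.Re `|x|.

Definition orthonormal_basis (R : realType) (H : hilbert R) (e : nat -> H) :=
  (forall i j, hdot (e i) (e j) = (i == j)%:R) /\
  (forall x : H, (fun N => \sum_(k < N) hdot (e k) x *: e k) @ \oo --> x).

Definition weights (R : realType) (lam : nat -> R) : Prop :=
  [/\ 1 < lam 0%N,
      forall m n, (m <= n)%N -> lam m <= lam n &
      (\sum_(0 <= k <oo) (lam k ^- 2)%:E < +oo)%E].

(* |x|_r ^ 2 for x in H, possibly infinite *)
Definition wnorm2 (R : realType) (H : hilbert R) (e : nat -> H)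
    (lam : nat -> R) (r : R) (x : H) : \bar R :=
  (\sum_(0 <= k <oo)
     (lam k `^ (2 * r) * Normc.normc (hdot (e k) x) ^+ 2)%:E)%E.

Definition test_space (R : realType) (H : hilbert R) (e : nat -> H)
    (lam : nat -> R) : set H :=
  [set x | forall r : R, 0 <= r -> (wnorm2 e lam r x < +oo)%E].

(* The dual E^* of E. A linear functional is continuous for the projective
   limit topology of E iff it is bounded for one of the (increasing) norms
   |.|_r, r >= 0. Only the values on E of the underlying function are
   relevant; they are the values of the bilinear pairing of E^* with E. *)
Record dual (R : realType) (H : hilbert R) (e : nat -> H) (lam : nat -> R) :=
  Dual {
  dual_fun :> H -> R[i] ;
  dual_linear : forall (c : R[i]) (x y : H),
    test_space e lam x -> test_space e lam y ->
    dual_fun (c *: x + y) = c * dual_fun x + dual_fun y ;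
  dual_bounded : exists r C : R, 0 <= r /\ 0 <= C /\
    forall x : H, test_space e lam x ->
      ((Normc.normc (dual_fun x) ^+ 2)%:E <= C%:E * wnorm2 e lam r x)%E
}.

(* The spaces E_{-r} for r >= 0: [neg_scale_space S r] is a completion of H
   for |.|_{-r}, and [neg_scale_incl S r s], for r <= s, is the inclusion of
   E_{-r} in E_{-s}, i.e. the continuous extension of the identity of H. These
   properties determine the data up to a unique isomorphism. Indices outside
   the stated range carry no meaning. *)
Record neg_scale (R : realType) (H : hilbert R) (e : nat -> H)
    (lam : nat -> R) := NegScale {
  neg_scale_space :> R -> hilbert R ;
  neg_scale_in : forall r : R, {linear H -> neg_scale_space r} ;
  neg_scale_norm : forall (r : R) (x : H), 0 <= r ->
    (rnorm (neg_scale_in r x) ^+ 2)%:E = wnorm2 e lam (- r) x ;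
  neg_scale_dense : forall r : R, 0 <= r ->
    closure (range (neg_scale_in r)) = [set: neg_scale_space r] ;
  neg_scale_incl : forall r s : R,
    {linear neg_scale_space r -> neg_scale_space s} ;
  neg_scale_incl_continuous : forall r s : R, 0 <= r -> r <= s ->
    continuous (neg_scale_incl r s) ;
  neg_scale_inclE : forall (r s : R) (x : H), 0 <= r -> r <= s ->
    neg_scale_incl r s (neg_scale_in r x) = neg_scale_in s x
}.

(* [F] in E^* is the element [x] of E_{-r}: for x in H the pairing is
   sum_k alpha_k beta_k, which is extended to E_{-r} by continuity. *)
Definition represents (R : realType) (H : hilbert R) (e : nat -> H)
    (lam : nat -> R) (S : neg_scale e lam) (r : R) (x : S r)
    (F : dual e lam) : Prop :=
  exists h : nat -> H,
    (fun m => neg_scale_in S r (h m)) @ \oo --> x /\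
    forall y : H, test_space e lam y ->
      (fun m => limn (fun N =>
         \sum_(k < N) hdot (e k) (h m) * hdot (e k) y : R[i]^o)) @ \oo
      --> (F y : R[i]^o).

(* Hilbert space tensor powers of K, characterised up to a unique isomorphism:
   [tensor x] is x_0 (x) ... (x) x_(n-1). For n = 0 this is a one-dimensional
   space with a distinguished unit vector, i.e. the field of scalars. *)
Record tensor_power (R : realType) (K : hilbert R) (n : nat) := TensorPower {
  tensor_space :> hilbert R ;
  tensor : ('I_n -> K) -> tensor_space ;
  tensor_linear : forall (x : 'I_n -> K) (i : 'I_n) (c : R[i]) (u v : K),
    tensor (dfwith x i (c *: u + v)) =
    c *: tensor (dfwith x i u) + tensor (dfwith x i v) ;
  hdot_tensor : forall x y : 'I_n -> K,
    hdot (tensor x) (tensor y) = \prod_(i < n) hdot (x i) (y i) ;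
  tensor_total :
    closure [set t | exists s : seq (R[i] * ('I_n -> K)),
                       t = \sum_(cx <- s) cx.1 *: tensor cx.2]
    = [set: tensor_space]
}.

(* Membership in the symmetric tensor power: f is invariant under the unitary
   permutations of the tensor factors, tested against elementary tensors. *)
Definition symmetric_tensor (R : realType) (K : hilbert R) (n : nat)
    (T : tensor_power K n) (f : T) : Prop :=
  forall (s : 'S_n) (x : 'I_n -> K),
    hdot (tensor T (x \o s)) f = hdot (tensor T x) f.

Definition fock (R : realType) (K : hilbert R)
    (T : forall n, tensor_power K n) : set (forall n, T n) :=
  [set f | (forall n, symmetric_tensor (f n)) /\
           (\sum_(0 <= n <oo) (n`!%:R * rnorm (f n) ^+ 2)%:E < +oo)%E].
Arguments fock {R K} T _.

(* B is the n-th tensor power of the linear map A. *)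
Definition is_tensor_map (R : realType) (K L : hilbert R) (n : nat)
    (TK : tensor_power K n) (TL : tensor_power L n) (A : K -> L)
    (B : {linear TK -> TL}) : Prop :=
  continuous B /\ forall x : 'I_n -> K, B (tensor TK x) = tensor TL (A \o x).

(* The tensor powers of the E_{-r} and the inclusions between them *)
Record neg_tensor_scale (R : realType) (H : hilbert R) (e : nat -> H)
    (lam : nat -> R) (S : neg_scale e lam) (n : nat) := NegTensorScale {
  neg_tensor :> forall r : R, tensor_power (S r) n ;
  neg_tensor_incl : forall r s : R, {linear neg_tensor r -> neg_tensor s} ;
  neg_tensor_inclP : forall r s : R, 0 <= r -> r <= s ->
    is_tensor_map (neg_scale_incl S r s) (neg_tensor_incl r s)
}.

(* t in E_{-r}^{(x) n} and t' in E_{-s}^{(x) n} are the same element of the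
   union of these spaces. *)
Definition same_element (R : realType) (H : hilbert R) (e : nat -> H)
    (lam : nat -> R) (S : neg_scale e lam) (n : nat)
    (T : neg_tensor_scale S n) (r s : R) (t : T r) (t' : T s) : Prop :=
  forall m : R, r <= m -> s <= m ->
    neg_tensor_incl T r m t = neg_tensor_incl T s m t'.

(* For r >= 0, the Hilbert space of all x in H with |x|_r finite *)
Record weighted_space (R : realType) (H : hilbert R) (e : nat -> H)
    (lam : nat -> R) (r : R) := WeightedSpace {
  weighted_sort :> hilbert R ;
  weighted_in : {linear weighted_sort -> H} ;
  weighted_range :
    range weighted_in = [set x | (wnorm2 e lam r x < +oo)%E] ;
  weighted_norm : forall x : weighted_sort,
    (rnorm x ^+ 2)%:E = wnorm2 e lam r (weighted_in x)
}.

(* sum_{k_1,...,k_n} b_{k_1,...,k_n} x_{k_1} (x) ... (x) x_{k_n} in a tensor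
   power of K, with b_{k_1,...,k_n} = <u_{k_1} (x) ... (x) u_{k_n}, g>, as the
   limit of the partial sums over k_1, ..., k_n < N *)
Definition tensor_series (R : realType) (Hc K : hilbert R) (n : nat)
    (Tc : tensor_power Hc n) (TK : tensor_power K n)
    (u : nat -> Hc) (x : nat -> K) (g : Tc) : TK :=
  limn (fun N => \sum_(k : {ffun 'I_n -> 'I_N})
    hdot (tensor Tc (fun i => u (k i))) g *: tensor TK (fun i => x (k i))).

(* Main.v *)
Require Import Defs.
From HB Require Import structures.
From mathcomp Require Import all_boot all_order all_algebra all_fingroup.
From mathcomp Require Import all_classical all_reals all_analysis.
From mathcomp Require Import complex.
From mathcomp Require Import ring lra.
Set Implicit Arguments.
Unset Strict Implicit.
Unset Printing Implicit Defensive.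
Import Order.TTheory GRing.Theory Num.Theory numFieldNormedType.Exports.
Local Open Scope classical_set_scope.
Local Open Scope ring_scope.
Local Open Scope complex_scope.

(** Normalising the vectors of N_{a,1} sent to the e_{a,k} gives an orthonormal
    family v_k, and b_{k_1,...,k_n} is the coefficient of f_n on
    v_{k_1} (x) ... (x) v_{k_n} divided by lambda_{a,k_1} ... lambda_{a,k_n}.
    By Bessel and Cauchy-Schwarz, (sum |b|)^2 <= |f_n|^2 C^n with
    C = sum_k lambda_{a,k}^-2, so |i(f_n)|_{-p}^2 <= |f_n|^2 (C M^2)^n. The
    factor (C M^2)^n is absorbed by the inclusion of E_{-p} in E_{-q}, of norm at
    most lambda_1^-(q-p): as lambda_1 > 1, for q large |i(f_n)|_{-q} <= |f_n|. *)

(** * Real-valued norms on complex normed spaces *)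

Section Norms.
Variables (R : realType) (V : normedModType R[i]).

Lemma normE (x : V) : `|x| = (rnorm x)%:C.
Proof. by rewrite /rnorm RRe_real// normr_real. Qed.

Lemma complex_normE (z : R[i]) : `|z| = (Normc.normc z)%:C.
Proof. by []. Qed.

Lemma normc_ge0 (z : R[i]) : 0 <= Normc.normc z.
Proof. by rewrite -ler0c -complex_normE. Qed.

Lemma rnorm_ge0 (x : V) : 0 <= rnorm x.
Proof. by rewrite -ler0c -normE. Qed.

Lemma rnormZ (c : R[i]) (x : V) : rnorm (c *: x) = Normc.normc c * rnorm x.
Proof. by apply: complexI; rewrite rmorphM /= -complex_normE -!normE normrZ. Qed.

Lemma rnorm_sum (I : Type) (r : seq I) (P : pred I) (F : I -> V) :
  rnorm (\sum_(i <- r | P i) F i) <= \sum_(i <- r | P i) rnorm (F i).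
Proof.
rewrite -lecR rmorph_sum /= -normE; apply: (le_trans (ler_norm_sum _ _ _)).
by apply: ler_sum => i _; rewrite normE.
Qed.

Lemma rnorm_continuous : continuous (@rnorm R V).
Proof.
move=> x; apply/cvgrPdist_lt => e e0.
near=> y.
rewrite -ltcR (_ : (`|_|)%:C = `| `|x| - `|y| |); last first.
  by rewrite !normE -rmorphB complex_normE /= expr0n /= addr0 sqrtr_sqr.
apply: le_lt_trans (ler_dist_dist _ _) _.
by near: y; apply: cvgr_dist_lt; rewrite ?ltcR//; exact: cvg_id.
Unshelve. all: by end_near. Qed.

End Norms.

(** * Extension of identities and bounds from dense subsets *)

Section Density.
Variables (R : realType) (V W : normedModType R[i]).

Lemma closure_setT_eq (A D : set V) :
  closure A = setT -> closed D -> A `<=` D -> D = setT.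
Proof.
move=> AT cD AD; apply/seteqP; split=> // x _.
by apply: cD; apply: (closure_subset AD); rewrite AT.
Qed.

Lemma dense_ext (A : set V) (f g : {linear V -> W}) :
  closure A = setT -> continuous f -> continuous g ->
  (forall x, A x -> f x = g x) -> f =1 g.
Proof.
move=> AT cf cg fg x.
have cfg : continuous (fun x => f x - g x).
  by move=> y; apply: cvgB; [exact: cf|exact: cg].
suff /seteqP[_ /(_ x I)] : [set x | f x - g x = 0] = setT.
  by move/eqP; rewrite subr_eq0 => /eqP.
apply: (closure_setT_eq AT) => [|y /fg /= ->]; last by rewrite subrr.
apply: (@preimage_closed _ _ (fun x => f x - g x) [set 0]) => [y _|].
  exact: cfg.
apply: accessible_closed_set1; apply: hausdorff_accessible.
exact: norm_hausdorff.
Qed.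

(** The inequality cuts out a closed set, since both of its sides are continuous, and this set
    contains the dense set [A]. *)
Lemma dense_rnorm_le (A : set V) (f : {linear V -> W}) (c : R) :
  closure A = setT -> continuous f ->
  (forall x, A x -> rnorm (f x) <= c * rnorm x) ->
  forall x, rnorm (f x) <= c * rnorm x.
Proof.
move=> AT cf fc x.
have cfg : continuous (fun x => rnorm (f x) - c * rnorm x).
  move=> y; apply: cvgB; last first.
    by apply: cvgMr; exact: rnorm_continuous.
  by apply: (continuous_comp (cf y)); exact: rnorm_continuous.
suff /seteqP[_ /(_ x I)] : [set x | rnorm (f x) - c * rnorm x <= 0] = setT.
  by move=> /=; rewrite subr_le0.
apply: (closure_setT_eq AT) => [|y /fc /=]; last by rewrite subr_le0.
apply: (@preimage_closed _ _ (fun x => rnorm (f x) - c * rnorm x)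
  [set y | y <= 0]) => [y _|]; [exact: cfg|exact: closed_le].
Qed.
End Density.

(** * Limits of sequences in normed spaces *)

Lemma rnorm_cvg_le (R : realType) (V : normedModType R[i]) (s : nat -> V)
    (x : V) (B : R) :
  s @ \oo --> x -> (forall n, rnorm (s n) <= B) -> rnorm x <= B.
Proof.
move=> sx sB; have cs : (fun n => rnorm (s n)) @ \oo --> rnorm x.
  exact: (continuous_cvg _ (@rnorm_continuous R V x) sx).
rewrite -(cvg_lim _ cs)//; apply: limr_le; first by apply/cvg_ex; exists (rnorm x).
exact: nearW.
Qed.

(** [A] is nondecreasing and bounded, hence Cauchy, and [s] inherits this. Increments rather than
    terms are compared because sums over growing boxes add a whole shell at a time. *)
Lemma cvgn_of_dominated_increments (R : realType) (V : completeNormedModType R[i])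
    (s : nat -> V) (A : nat -> R) (B : R) :
  (forall m n, (m <= n)%N -> rnorm (s n - s m) <= A n - A m) ->
  (forall n, A n <= B) -> cvgn s.
Proof.
move=> sA AB; apply: cauchy_cvg; apply: cauchy_exP => eps eps0.
have ndA : {homo A : m n / (m <= n)%N >-> m <= n}.
  move=> m n mn; rewrite -subr_ge0.
  exact: le_trans (rnorm_ge0 _) (sA _ _ mn).
have cA : cvgn A.
  by apply: nondecreasing_is_cvgn => //; exists B => _ [n _ <-].
(* Radii of balls live in [R[i]]; being positive, [eps] is real. *)
have epsE : eps = (complex.Re eps)%:C by rewrite RRe_real// gtr0_real.
have e0 : 0 < complex.Re eps by rewrite -ltcR -epsE.
have /cvgrPdist_lt/(_ _ e0)[N _ /(_ N (leqnn N)) /= AN] := cA.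
exists (s N); exists N => // n /= Nn.
rewrite -ball_normE /= distrC normE epsE ltcR.
apply: le_lt_trans (sA _ _ Nn) _; apply: le_lt_trans AN.
apply: le_trans (ler_norm _); rewrite lerB//.
exact: nondecreasing_cvgn_le.
Qed.

(** * Inner products, Bessel and Cauchy-Schwarz *)

Section Hilbert.
Variables (R : realType) (H : hilbert R).
Implicit Types x y z : H.

Lemma hdotDr x y z : hdot x (y + z) = hdot x y + hdot x z.
Proof. by have := hdot_linear x 1 y z; rewrite scale1r mul1r. Qed.

Lemma hdot0r x : hdot x 0 = 0.
Proof. by apply: (addIr (hdot x 0)); rewrite -hdotDr !add0r. Qed.

Lemma hdotZr c x y : hdot x (c *: y) = c * hdot x y.
Proof. by have := hdot_linear x c y 0; rewrite hdot0r !addr0. Qed.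

Lemma hdotBr x y z : hdot x (y - z) = hdot x y - hdot x z.
Proof. by rewrite -scaleN1r hdotDr hdotZr mulN1r. Qed.

Lemma hdotDl x y z : hdot (x + y) z = hdot x z + hdot y z.
Proof. by rewrite hdotC hdotDr rmorphD /= -!hdotC. Qed.

Lemma hdotZl c x y : hdot (c *: x) y = c^*%C * hdot x y.
Proof. by rewrite hdotC hdotZr rmorphM /= -hdotC. Qed.

Lemma hdotBl x y z : hdot (x - y) z = hdot x z - hdot y z.
Proof. by rewrite hdotC hdotBr rmorphB /= -!hdotC. Qed.

Lemma hdot_sumr (I : Type) (r : seq I) (P : pred I) (F : I -> H) x :
  hdot x (\sum_(i <- r | P i) F i) = \sum_(i <- r | P i) hdot x (F i).
Proof. exact: (big_morph _ (hdotDr x) (hdot0r x)). Qed.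

Lemma hdot_suml (I : Type) (r : seq I) (P : pred I) (F : I -> H) x :
  hdot (\sum_(i <- r | P i) F i) x = \sum_(i <- r | P i) hdot (F i) x.
Proof.
rewrite hdotC hdot_sumr rmorph_sum; apply: eq_bigr => i _ /=.
by rewrite -hdotC.
Qed.

Lemma hdotxxE x : hdot x x = (rnorm x ^+ 2)%:C.
Proof. by rewrite hdotxx normE rmorphXn. Qed.

(** Expand [|x - y|^2 >= 0] for the projection [y] of [x] on the span of the family: [<y, x>],
    [<x, y>] and [<y, y>] all equal the sum on the left. *)
Lemma bessel (I : finType) (v : I -> H) x :
  (forall i j, hdot (v i) (v j) = (i == j)%:R) ->
  \sum_i Normc.normc (hdot (v i) x) ^+ 2 <= rnorm x ^+ 2.
Proof.
move=> ov; set y := \sum_i hdot (v i) x *: v i.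
have vy i : hdot (v i) y = hdot (v i) x.
  rewrite hdot_sumr (bigD1 i)//= hdotZr ov eqxx mulr1 big1 ?addr0// => j ji.
  by rewrite hdotZr ov eq_sym (negbTE ji) mulr0.
have yE z : (forall i, hdot (v i) z = hdot (v i) x) ->
    hdot y z = (\sum_i Normc.normc (hdot (v i) x) ^+ 2)%:C.
  move=> vz; rewrite hdot_suml rmorph_sum; apply: eq_bigr => i _ /=.
  by rewrite hdotZl vz mulrC -sqr_normc complex_normE rmorphXn.
have := exprn_ge0 2 (rnorm_ge0 (x - y)).
rewrite -ler0c -hdotxxE hdotBl !hdotBr hdotxxE !yE// subrr subr0.
by rewrite (hdotC y x) yE// conjc_real -rmorphB ler0c subr_ge0.
Qed.

(** Bessel for the one-element family [x / |x|]; the case [x = 0] is separate. *)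
Lemma hdot_le x y : Normc.normc (hdot x y) <= rnorm x * rnorm y.
Proof.
have [x0|x0] := eqVneq (rnorm x) 0.
  have -> : x = 0 by apply/eqP; rewrite -normr_eq0 normE x0.
  by rewrite hdotC hdot0r rmorph0 Normc.normc0 mulr_ge0// rnorm_ge0.
have xp : 0 < rnorm x by rewrite lt_def x0 rnorm_ge0.
set v := (rnorm x)^-1%:C *: x.
have vv (i j : 'I_1) : hdot v v = (i == j)%:R.
  rewrite !ord1 eqxx hdotZl hdotZr conjc_real hdotxxE -!rmorphM /=.
  by rewrite expr2 mulKf// mulVf.
have := bessel y vv.
rewrite big_ord1 hdotZl conjc_real.
rewrite ler_sqr ?nnegrE ?normc_ge0 ?rnorm_ge0// Normc.normcM.
have -> : Normc.normc (rnorm x)^-1%:C = (rnorm x)^-1.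
  by apply: complexI; rewrite -complex_normE ger0_norm// ler0c invr_ge0 ltW.
by rewrite ler_pdivrMl.
Qed.

(** Values are taken in the normed module [R[i]^o] so that the functional can carry a linear
    structure and enter the density arguments. *)
Definition hdot_lin x (y : H) : R[i]^o := hdot x y.

Lemma hdot_lin_linear x : linear (hdot_lin x).
Proof. exact: hdot_linear. Qed.

HB.instance Definition _ x :=
  GRing.isLinear.Build R[i] H R[i]^o _ (hdot_lin x) (hdot_lin_linear x).

Lemma hdot_continuous x : continuous (hdot x : H -> R[i]^o).
Proof.
move=> y; apply/cvgrPdist_lt => eps eps0.
have epsE : eps = (complex.Re eps)%:C by rewrite RRe_real// gtr0_real.
have e0 : 0 < complex.Re eps by rewrite -ltcR -epsE.
(* The [+ 1] keeps the denominator positive when [x = 0]. *)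
have d0 : 0 < complex.Re eps / (rnorm x + 1).
  by rewrite divr_gt0// ltr_wpDl// rnorm_ge0.
near=> z.
rewrite /= -hdotBr complex_normE epsE ltcR.
apply: le_lt_trans (hdot_le _ _) _.
apply: (@le_lt_trans _ _ ((rnorm x + 1) * rnorm (y - z))).
  by rewrite ler_wpM2r ?rnorm_ge0// lerDl.
rewrite -ltr_pdivlMl ?ltr_wpDl ?rnorm_ge0// mulrC -ltcR -normE.
by near: z; apply: cvgr_dist_lt; rewrite ?ltcR//; exact: cvg_id.
Unshelve. all: by end_near. Qed.
End Hilbert.

(** * Multiple series summed over growing boxes *)

Section Boxes.
Variables (R : realType) (n : nat).

(* Stated over the values [fun i => k i : nat], so that boxes of different
   sizes are summed with the same summand. *)
Lemma box_split (V : zmodType) (F : ('I_n -> nat) -> V) (m N : nat) :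
  (m <= N)%N ->
  \sum_(k : {ffun 'I_n -> 'I_N}) F (fun i => k i) =
  \sum_(k : {ffun 'I_n -> 'I_m}) F (fun i => k i) +
  \sum_(k : {ffun 'I_n -> 'I_N} | ~~ [forall i, k i < m]%N) F (fun i => k i).
Proof.
move=> mN; rewrite (bigID (fun k : {ffun 'I_n -> 'I_N} => [forall i, k i < m]%N)).
congr (_ + _).
pose h (k : {ffun 'I_n -> 'I_m}) := [ffun i => widen_ord mN (k i)].
have h_inj : injective h.
  move=> k l /ffunP kl; apply/ffunP => i; apply: val_inj.
  by have := kl i; rewrite !ffunE => /(congr1 val).
transitivity (\sum_(k in h @: finset.setT) F (fun i => k i)).
  apply: eq_bigl => k; apply/forallP/imsetP => [km|[l _ ->] i].
    exists [ffun i => Ordinal (km i)] => //.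
    by apply/ffunP => i; rewrite !ffunE; apply: val_inj.
  by rewrite ffunE /=.
rewrite big_imset /=; last by move=> ? ? _ _; exact: h_inj.
apply: eq_big => [k|k _]; first by rewrite inE.
by congr F; apply/funext => i; rewrite ffunE.
Qed.

(** A Weierstrass test: two box sums of [F] differ by the sum over a shell, whose norm is at most
    the corresponding increment for [G]. *)
Lemma box_series_cvg (V : completeNormedModType R[i])
    (F : ('I_n -> nat) -> V) (G : ('I_n -> nat) -> R) (B : R) :
  (forall k, rnorm (F k) <= G k) ->
  (forall N, \sum_(k : {ffun 'I_n -> 'I_N}) G (fun i => k i) <= B) ->
  cvgn (fun N => \sum_(k : {ffun 'I_n -> 'I_N}) F (fun i => k i)).
Proof.
move=> FG GB.
apply: (@cvgn_of_dominated_increments _ _ _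
  (fun N => \sum_(k : {ffun 'I_n -> 'I_N}) G (fun i => k i)) B) => // m N mN.
rewrite !(box_split _ mN) ![_ + _ - _]addrAC !subrr !add0r.
by apply: le_trans (rnorm_sum _ _ _) _; apply: ler_sum => k _.
Qed.

Lemma sum_CauchySchwarz (I : finType) (c d : I -> R) :
  (\sum_i c i * d i) ^+ 2 <= (\sum_i c i ^+ 2) * (\sum_i d i ^+ 2).
Proof.
set Z := \sum_i c i * d i; set X := \sum_i c i ^+ 2; set Y := \sum_i d i ^+ 2.
have : 0 <= Y by apply: sumr_ge0 => i _; exact: sqr_ge0.
rewrite le_eqVlt => /orP[/eqP Y0|Y0].
  suff -> : Z = 0 by rewrite expr0n -Y0 mulr0.
  apply: big1 => i _; have /eqP := esym Y0.
  rewrite psumr_eq0 => [|j _]; last exact: sqr_ge0.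
  by move=> /allP/(_ i); rewrite mem_index_enum sqrf_eq0 => /(_ isT)/eqP->; rewrite mulr0.
(* Multiplied by [Y > 0], the gap [X Y - Z^2] becomes the sum of the squares [(c_i Y - d_i Z)^2]. *)
rewrite -subr_ge0 -(pmulr_rge0 _ Y0).
have E a b : \sum_i (c i * b - d i * a) ^+ 2 =
    b ^+ 2 * X - 2 * b * a * Z + a ^+ 2 * Y.
  rewrite !mulr_sumr -sumrB -big_split /=.
  by apply: eq_bigr => i _; ring.
have -> : Y * (X * Y - Z ^+ 2) = \sum_i (c i * Y - d i * Z) ^+ 2.
  by rewrite E; ring.
by apply: sumr_ge0 => i _; exact: sqr_ge0.
Qed.

End Boxes.

(** * Tensor powers: density, norms and symmetry *)

Section Tensors.
Variables (R : realType) (K : hilbert R) (n : nat) (T : tensor_power K n).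

Lemma tensor_ext (W : normedModType R[i]) (f g : {linear T -> W}) :
  continuous f -> continuous g ->
  (forall x, f (tensor T x) = g (tensor T x)) -> f =1 g.
Proof.
move=> cf cg fg; apply: (dense_ext (tensor_total T) cf cg) => _ [s ->].
by rewrite !linear_sum; apply: eq_bigr => cx _; rewrite !linearZ /= fg.
Qed.

Lemma rnorm_tensor (x : 'I_n -> K) :
  rnorm (tensor T x) = \prod_i rnorm (x i).
Proof.
apply/eqP; rewrite -(@eqrXn2 _ 2) ?rnorm_ge0 ?prodr_ge0// => [|i _].
  by rewrite -prodrXl; apply/eqP/complexI; rewrite -hdotxxE hdot_tensor rmorph_prod;
    apply: eq_bigr => i _ /=; rewrite hdotxxE.
exact: rnorm_ge0.
Qed.

Lemma rnorm_tensor_le (x : 'I_n -> K) (B : R) :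
  (forall i, rnorm (x i) <= B) -> rnorm (tensor T x) <= B ^+ n.
Proof.
move=> xB; rewrite rnorm_tensor -[in leRHS](card_ord n) -prodr_const.
by apply: ler_prod => i _; rewrite rnorm_ge0 xB.
Qed.

(** Distinct multi-indices differ in some slot, and the factor of that slot vanishes. *)
Lemma orthonormal_tensor (v : nat -> K) (N : nat) :
  (forall i j, hdot (v i) (v j) = (i == j)%:R) ->
  forall k l : {ffun 'I_n -> 'I_N},
    hdot (tensor T (fun i => v (k i))) (tensor T (fun i => v (l i))) =
    (k == l)%:R.
Proof.
move=> ov k l; rewrite hdot_tensor; have [->|kl] := eqVneq k l.
  by apply: big1 => i _; rewrite ov eqxx.
have [i ki] : exists i, k i != l i.
  apply/existsP; apply: contraNT kl => /existsPn kl.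
  by apply/eqP/ffunP => i; apply/eqP; have := kl i; rewrite negbK.
by rewrite (bigD1 i)//= ov val_eqE (negbTE ki) mul0r.
Qed.

(** Pairing with a fixed vector is continuous, so symmetry can be checked on the partial sums. There
    it is a change of index, because boxes are stable under permuting the slots. *)
Lemma symmetric_tensor_lim (b : ('I_n -> nat) -> R[i]) (y : nat -> K) (t : T) :
  (forall (s : 'S_n) k, b (k \o s) = b k) ->
  (fun N => \sum_(k : {ffun 'I_n -> 'I_N})
     b (fun i => k i) *: tensor T (fun i => y (k i))) @ \oo --> t ->
  symmetric_tensor t.
Proof.
set S := fun N => _; move=> bs St s x.
have St' z : (fun N => hdot z (S N) : R[i]^o) @ \oo --> (hdot z t : R[i]^o).
  exact: (continuous_cvg _ (@hdot_continuous R T z t) St).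
suff E N : hdot (tensor T (x \o s)) (S N) = hdot (tensor T x) (S N).
  have := St' (tensor T (x \o s)); under eq_fun do rewrite E.
  by move/(@cvg_unique _ (@norm_hausdorff _ _)); apply; exact: St'.
rewrite !hdot_sumr.
pose h (k : {ffun 'I_n -> 'I_N}) := [ffun i => k (s i)].
have h_inj : injective h.
  move=> k l /ffunP kl; apply/ffunP => i.
  by have := kl (s^-1 i)%g; rewrite !ffunE permKV.
rewrite (reindex_inj h_inj); apply: eq_bigr => k _.
rewrite !hdotZr !hdot_tensor; congr (_ * _).
  by rewrite -(bs s (fun i => k i)); congr b; apply/funext => i; rewrite /= ffunE.
rewrite [RHS](reindex_inj (@perm_inj _ s)).
by apply: eq_bigr => i _; rewrite ffunE.
Qed.

End Tensors.

(** * Orthonormal vectors in a weighted space *)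

Section Weighted.
Variables (R : realType) (H : hilbert R) (u : nat -> H) (lam : nat -> R) (r : R).
Hypotheses (ou : forall i j, hdot (u i) (u j) = (i == j)%:R).
Hypotheses (lam_gt0 : forall k, 0 < lam k).

Let term (y : H) (k : nat) : \bar R :=
  (lam k `^ (2 * r) * Normc.normc (hdot (u k) y) ^+ 2)%:E.

Let term_ge0 y k : (0 <= term y k)%E.
Proof. by rewrite lee_fin mulr_ge0 ?powR_ge0// exprn_ge0 ?normc_ge0. Qed.

Lemma wnorm2D1 (k : nat) (y : H) :
  wnorm2 u lam r y = (term y k + \sum_(0 <= j <oo | j != k) term y j)%E.
Proof. by apply: nneseriesD1 => // j _; exact: term_ge0. Qed.

Lemma wnorm2_basis k : wnorm2 u lam r (u k) = (lam k `^ (2 * r))%:E.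
Proof.
rewrite (wnorm2D1 k) eseries0 => [|j _ jk].
  by rewrite /term ou eqxx Normc.normc1 expr1n mulr1 adde0.
by rewrite /term ou (negbTE jk) Normc.normc0 expr0n mulr0.
Qed.

Variable N : weighted_space u lam r.

(** The weighted space is specified by its norm alone, so its inner product is recovered by
    polarisation: adding a multiple of [w] to [x] alters only coordinate [k] of the image. *)
Lemma hdot_weighted (w x : N) k : weighted_in N w = u k ->
  hdot w x = (lam k `^ (2 * r))%:C * hdot (u k) (weighted_in N x).
Proof.
move=> wk; set a := lam k `^ (2 * r); set al := hdot (u k) _.
have ww : hdot w w = a%:C.
  have := weighted_norm w; rewrite wk wnorm2_basis => -[waE].
  by rewrite hdotxxE waE.
(* Two computations of [|x + c w|^2 - |x|^2] are compared, by sesquilinearity and by coordinates;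
   the common term in [|c|^2] cancels. *)
have key c : c * (hdot w x)^*%C + c^*%C * hdot w x =
    a%:C * (c * al^*%C + c^*%C * al).
  have rest : (\sum_(0 <= j <oo | j != k) term (weighted_in N (x + c *: w)%R) j =
      \sum_(0 <= j <oo | j != k) term (weighted_in N x) j)%E.
    apply: eq_eseriesr => j jk.
    by rewrite /term linearD linearZ /= wk hdotDr hdotZr ou (negbTE jk) mulr0 addr0.
  have := weighted_norm (x + c *: w); have := weighted_norm x.
  rewrite !(wnorm2D1 k) rest.
  rewrite /term linearD linearZ /= wk hdotDr hdotZr ou eqxx mulr1 -/a -/al.
  (* The norms being finite, the sum over the other coordinates cannot be infinite. *)
  case: (\sum_(0 <= j <oo | _) _)%E => [s| |] // -[xE] -[xcE].
  have : hdot (x + c *: w) (x + c *: w) - hdot x x =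
      a%:C * (`|al + c| ^+ 2 - `|al| ^+ 2).
    rewrite !hdotxxE xE xcE !complex_normE -!rmorphXn -!rmorphB -rmorphM /=.
    by congr (_%:C); ring.
  rewrite !hdotDl !hdotDr !hdotZl !hdotZr ww (hdotC w x) !sqr_normc rmorphD /=.
  move=> E; move: E; set d := hdot w x; set X := hdot x x => E.
  apply: (addIr (c * c^*%C * a%:C)).
  transitivity (X + c * d^*%C + (c^*%C * d + c^*%C * (c * a%:C)) - X).
    by ring.
  by rewrite E; ring.
(* [c = 1] compares the real parts, [c = 'i] the imaginary parts. *)
have := key 1; have := key 'i%C; clear key ww; move: (hdot w x) al.
move=> [d1 d2] [a1 a2]; simpc => -[h2] [h1 _].
by congr (_ +i* _); lra.
Qed.

Lemma weighted_orthonormal : exists v : nat -> N,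
  (forall i j, hdot (v i) (v j) = (i == j)%:R) /\
  forall k x, hdot (u k) (weighted_in N x) = (lam k `^ (- r))%:C * hdot (v k) x.
Proof.
have /choice[w wE] k : exists w : N, weighted_in N w = u k.
  have : [set x | (wnorm2 u lam r x < +oo)%E] (u k).
    by rewrite /= wnorm2_basis ltry.
  by rewrite -(weighted_range N) => -[w _ wk]; exists w.
have vE k x : hdot (u k) (weighted_in N x) =
    (lam k `^ (- r))%:C * hdot ((lam k `^ (- r))%:C *: w k) x.
  rewrite hdotZl conjc_real (hdot_weighted _ (wE k)) !mulrA -!rmorphM /=.
  rewrite -!powRD ?(gt_eqF (lam_gt0 k)) ?implybT//.
  by rewrite (_ : - r - r + 2 * r = 0) ?powRr0 ?mul1r//; ring.
exists (fun k => (lam k `^ (- r))%:C *: w k); split=> // i j.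
have lN0 : (lam i `^ (- r))%:C != 0 :> R[i].
  by rewrite -(rmorph0 (real_complex R)) (inj_eq (@complexI _)) gt_eqF// powR_gt0.
(* Orthonormality is the coordinate formula applied to the family itself, after cancelling a nonzero
   weight. *)
apply: (mulfI lN0); rewrite -vE linearZ /= wE hdotZr ou.
by have [->|] := eqVneq; rewrite ?mulr0.
Qed.
End Weighted.

(** * Coefficients of tensors over the weighted space *)

Section WeightedTensor.
Variables (R : realType) (Hc : hilbert R) (u : nat -> Hc) (lam : nat -> R).
Variables (r : R) (N1 : weighted_space u lam r) (n : nat).
Variables (Tc : tensor_power Hc n) (TN : tensor_power N1 n).
Variable inN : {linear TN -> Tc}.
Hypothesis hinN : is_tensor_map (weighted_in N1) inN.
Variable v : nat -> N1.
Hypothesis ov : forall i j, hdot (v i) (v j) = (i == j)%:R.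
Hypothesis uv : forall k x,
  hdot (u k) (weighted_in N1 x) = (lam k `^ (- r))%:C * hdot (v k) x.

(** Both sides are continuous linear functionals of [f], so elementary tensors suffice, and there
    the identity is a product of copies of [uv]. *)
Lemma weighted_tensor_coef (k : 'I_n -> nat) (f : TN) :
  hdot (tensor Tc (fun i => u (k i))) (inN f) =
  (\prod_i lam (k i) `^ (- r))%:C * hdot (tensor TN (fun i => v (k i))) f.
Proof.
set U := tensor Tc _; set V := tensor TN _; set d := \prod_i _.
have [cin inE] := hinN.
suff /(_ f) : hdot_lin U \o inN =1 hdot_lin (d%:C *: V).
  by rewrite /= /hdot_lin hdotZl conjc_real.
apply: (@tensor_ext _ _ _ TN R[i]^o _ (hdot_lin (d%:C *: V))) => [y||x].
- by apply: (continuous_comp (cin y)); exact: hdot_continuous.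
- exact: hdot_continuous.
rewrite /= /hdot_lin inE hdotZl conjc_real !hdot_tensor rmorph_prod -big_split.
by apply: eq_bigr => i _ /=; rewrite uv.
Qed.

Lemma weighted_tensor_coef_sum (f : TN) (N : nat) :
  (\sum_(k : {ffun 'I_n -> 'I_N})
     Normc.normc (hdot (tensor Tc (fun i => u (k i))) (inN f))) ^+ 2 <=
  rnorm f ^+ 2 * (\sum_(j < N) (lam j `^ (- r)) ^+ 2) ^+ n.
Proof.
have E (k : {ffun 'I_n -> 'I_N}) :
    Normc.normc (hdot (tensor Tc (fun i => u (k i))) (inN f)) =
    Normc.normc (hdot (tensor TN (fun i => v (k i))) f) *
    \prod_i lam (k i) `^ (- r).
  rewrite weighted_tensor_coef Normc.normcM mulrC; congr (_ * _).
  apply: complexI; rewrite -complex_normE ger0_norm// ler0c.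
  by apply: prodr_ge0 => i _; exact: powR_ge0.
rewrite (eq_bigr _ (fun k _ => E k)).
apply: le_trans (sum_CauchySchwarz _ _) _.
(* Summing a product over independent indices gives the [n]-th power of the one-index sum. *)
have -> : \sum_(k : {ffun 'I_n -> 'I_N}) (\prod_i lam (k i) `^ (- r)) ^+ 2 =
    (\sum_(j < N) (lam j `^ (- r)) ^+ 2) ^+ n.
  rewrite -[in RHS](card_ord n) -prodr_const bigA_distr_bigA /=.
  by apply: eq_bigr => k _; rewrite prodrXl.
rewrite ler_wpM2r ?exprn_ge0 ?sumr_ge0// => [j _|]; first exact: sqr_ge0.
exact: (bessel f (orthonormal_tensor TN ov)).
Qed.

Lemma weighted_tensor_coef_perm (f : TN) (s : 'S_n) (k : 'I_n -> nat) :
  symmetric_tensor f ->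
  hdot (tensor Tc (fun i => u ((k \o s) i))) (inN f) =
  hdot (tensor Tc (fun i => u (k i))) (inN f).
Proof.
move=> fs; rewrite !weighted_tensor_coef; congr (_%:C * _).
  by rewrite [RHS](reindex_inj (@perm_inj _ s)).
exact: (fs s (fun i => v (k i))).
Qed.

End WeightedTensor.

(** * Norms and composition of the inclusions between negative spaces *)

Section NegScale.
Variables (R : realType) (H : hilbert R) (e : nat -> H) (lam : nat -> R).
Variable S : neg_scale e lam.
Hypothesis hlam : weights lam.

Lemma weights_gt0 k : 0 < lam k.
Proof.
have [lam0 ndlam _] := hlam.
by apply: lt_le_trans (ndlam _ _ (leq0n k)); exact: lt_trans lam0.
Qed.

(** On the dense image of [H] the two weighted sums compare term by term: passing from [r] to [s]
    costs [lam k ^ (-2 (s - r))], which is largest at [k = 0]. *)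
Lemma neg_scale_incl_le (r s : R) (x : S r) : 0 <= r -> r <= s ->
  rnorm (neg_scale_incl S r s x) <= lam 0%N `^ (- (s - r)) * rnorm x.
Proof.
move=> r0 rs; have s0 := le_trans r0 rs.
apply: (dense_rnorm_le (neg_scale_dense S r0)) => [|_ [y _ <-]].
  exact: neg_scale_incl_continuous.
rewrite neg_scale_inclE//.
rewrite -ler_sqr ?nnegrE ?mulr_ge0 ?powR_ge0 ?rnorm_ge0// -lee_fin exprMn [X in (_ <= X)%E]EFinM.
rewrite !neg_scale_norm// /wnorm2 -nneseriesZl; last first.
  by move=> k _; rewrite lee_fin mulr_ge0 ?powR_ge0// exprn_ge0// normc_ge0.
apply: lee_nneseries => k _.
  by rewrite lee_fin mulr_ge0 ?powR_ge0// exprn_ge0// normc_ge0.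
rewrite -EFinM lee_fin [leRHS]mulrA ler_wpM2r ?exprn_ge0 ?normc_ge0//.
have -> : lam k `^ (2 * - s) = lam k `^ (- (s - r)) ^+ 2 * lam k `^ (2 * - r).
  rewrite expr2 -!powRD ?(gt_eqF (weights_gt0 k)) ?implybT//.
  by congr (_ `^ _); ring.
rewrite ler_wpM2r ?powR_ge0// ler_sqr ?nnegrE ?powR_ge0//.
rewrite !powRN lef_pV2 ?posrE ?powR_gt0 ?weights_gt0//.
have [_ ndlam _] := hlam.
by apply: ge0_ler_powR; rewrite ?subr_ge0 ?nnegrE ?(ltW (weights_gt0 _)) ?ndlam.
Qed.

(** Both sides are continuous and agree on the dense image of [H]. *)
Lemma neg_scale_incl_comp (r s m : R) (x : S r) : 0 <= r -> r <= s -> s <= m ->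
  neg_scale_incl S s m (neg_scale_incl S r s x) = neg_scale_incl S r m x.
Proof.
move=> r0 rs sm; have s0 := le_trans r0 rs; have rm := le_trans rs sm.
have crs := neg_scale_incl_continuous (n := S) r0 rs.
apply: (dense_ext (f := neg_scale_incl S s m \o neg_scale_incl S r s)
  (neg_scale_dense S r0)) => [y||_ [y _ <-]].
- by apply: (continuous_comp (crs y)); exact: neg_scale_incl_continuous.
- exact: neg_scale_incl_continuous.
- by rewrite /= !neg_scale_inclE.
Qed.

(** The inclusions are determined by elementary tensors, where the claim reduces to single factors.
    This yields [same_element] for a tensor and its image in a larger space. *)
Lemma neg_tensor_incl_comp (n : nat) (T : neg_tensor_scale S n) (r s m : R)
    (t : T r) : 0 <= r -> r <= s -> s <= m ->
  neg_tensor_incl T s m (neg_tensor_incl T r s t) = neg_tensor_incl T r m t.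
Proof.
move=> r0 rs sm; have s0 := le_trans r0 rs; have rm := le_trans rs sm.
have [crs rsE] := neg_tensor_inclP T r0 rs.
have [csm smE] := neg_tensor_inclP T s0 sm.
have [crm rmE] := neg_tensor_inclP T r0 rm.
apply: (tensor_ext (f := neg_tensor_incl T s m \o neg_tensor_incl T r s))
  => [y||x].
- by apply: (continuous_comp (crs y)); exact: csm.
- exact: crm.
- rewrite /= rsE smE rmE; congr (tensor _ _); apply/funext => i /=.
  exact: neg_scale_incl_comp.
Qed.

End NegScale.

(** * Numerical constants: the weight sum and the choice of the index *)

Lemma weights_sum_bound (R : realType) (lam : nat -> R) : weights lam ->
  exists C : R, forall N, \sum_(j < N) (lam j `^ (- 1)) ^+ 2 <= C.
Proof.
move=> hlam; have [_ _ slam] := hlam.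
set s := (\sum_(0 <= k <oo) _)%E in slam.
have t_ge0 k : (0 <= (lam k ^- 2)%:E)%E.
  by rewrite lee_fin invr_ge0 exprn_ge0// ltW// weights_gt0.
have s_fin : s \is a fin_num by rewrite ge0_fin_numE// nneseries_ge0.
exists (fine s) => N; rewrite -lee_fin fineK//.
apply: le_trans (nneseries_lim_ge N (fun k _ _ => t_ge0 k)).
rewrite sumEFin lee_fin big_mkord; apply: ler_sum => j _.
by rewrite powR_inv1 ?exprVn// ltW// weights_gt0.
Qed.

Lemma powRN_decay (R : realType) (l p D : R) : 1 < l -> 0 <= D ->
  exists q : nat, p <= q%:R /\ D * (l `^ (- (q%:R - p))) ^+ 2 <= 1.
Proof.
move=> l1 D0; have l0 : 0 < l by exact: lt_trans l1.
(* The exponent with [l ^ y = D + 1]; the [+ 1] keeps the logarithm nonnegative even when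
   [D < 1]. *)
pose y := ln (D + 1) / ln l.
have y0 : 0 <= y by rewrite divr_ge0// ln_ge0// ?lerDr// ltW.
exists (Num.bound (`|p| + y)); set q := _%:R.
have pq : `|p| + y < q by apply: archi_boundP; rewrite addr_ge0.
have yqp : y <= q - p.
  by rewrite lerBrDr (le_trans _ (ltW pq))// addrC lerD2r ler_norm.
split; first by rewrite -subr_ge0 (le_trans y0).
have : D + 1 <= l `^ (q - p).
  rewrite (le_trans _ (ler_powR (ltW l1) yqp))// /powR gt_eqF//.
  by rewrite divfK ?gt_eqF ?ln_gt0// lnK// posrE ltr_wpDl.
rewrite powRN exprVn; set z := l `^ _ => Dz.
have z0 : 0 < z by exact: powR_gt0.
by rewrite ler_pdivrMr ?exprn_gt0// mul1r; nra.
Qed.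

(** * The inclusion of Fock spaces *)

Theorem corollary3p3 (R : realType)
  (* H, E, E^*, the spaces E_{-r} and their tensor powers *)
  (H : hilbert R) (e : nat -> H) (he : orthonormal_basis e)
  (lam : nat -> R) (hlam : weights lam)
  (S : neg_scale e lam) (TE : forall n, neg_tensor_scale S n)
  (a : R) (ha : 1 / 2 < a)
  (ea : nat -> dual e lam)
  (C1 : forall k1 k2 : nat,
    (fun N : nat => ((N%:R `^ (2 * a - 1))^-1)%:C *
       (\sum_(j < N) (ea k1 (e j))^* * ea k2 (e j)) : R[i]^o) @ \oo
    --> ((k1 == k2)%:R : R[i]^o))
  (* (C2): [eap k] is ea k, as an element of E_{-p} *)
  (p M : R) (hp : 0 < p) (hM : 0 < M) (eap : nat -> S p)
  (heap : forall k, represents (eap k) (ea k))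
  (C2 : forall k, rnorm (eap k) <= M)
  (* (C3): the sum of the alpha_k ea_k, evaluated on E, is not zero *)
  (C3 : forall alpha : nat -> R[i],
    (\sum_(0 <= k <oo) (Normc.normc (alpha k))%:E < +oo)%E ->
    (exists k, alpha k != 0) ->
    ~ (forall y : H, test_space e lam y ->
         (fun N : nat => \sum_(k < N) alpha k * ea k y : R[i]^o) @ \oo
         --> (0 : R[i]^o)))
  (* H_{c,2a-1}; its basis vector [u k] is the one denoted e_{a,k} *)
  (Hc : hilbert R) (u : nat -> Hc) (hu : orthonormal_basis u)
  (Tc : forall n, tensor_power Hc n)
  (lama : nat -> R) (hlama : weights lama)
  (N1 : weighted_space u lama 1) (TN : forall n, tensor_power N1 n)
  (* the inclusions of the tensor powers of N_{a,1} in those of H_{c,2a-1} *)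
  (inN : forall n, {linear TN n -> Tc n})
  (hinN : forall n, is_tensor_map (weighted_in N1) (inN n))
  (phi : forall n, TN n) (hphi : fock TN phi) :
  exists (q : nat) (psi : forall n, TE n q%:R),
    fock (fun n => TE n q%:R) psi /\
    forall n,
      same_element (tensor_series (TE n p) u eap (inN n (phi n))) (psi n).
Proof.
have [v [ov uv]] := weighted_orthonormal hu.1 (weights_gt0 hlama) N1.
have [C hC] := weights_sum_bound hlama.
have C0 : 0 <= C by have := hC 0%N; rewrite big_ord0.
have [lam1 _ _] := hlam.
(* With [D = C M^2] each tensor slot contributes a factor at most 1, so one [q] serves every [n]. *)
have [q [pq hq]] := powRN_decay p lam1 (mulr_ge0 C0 (exprn_ge0 2 (ltW hM))).
have p0 := ltW hp.
pose b n (k : 'I_n -> nat) := hdot (tensor (Tc n) (fun i => u (k i))) (inN n (phi n)).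
have b_sum n N : (\sum_(k : {ffun 'I_n -> 'I_N}) Normc.normc (b n (fun i => k i))) ^+ 2
    <= rnorm (phi n) ^+ 2 * C ^+ n.
  apply: le_trans (weighted_tensor_coef_sum (hinN n) ov uv (phi n) N) _.
  rewrite ler_wpM2l ?exprn_ge0 ?rnorm_ge0// lerXn2r ?nnegrE//.
  by apply: sumr_ge0 => j _; exact: sqr_ge0.
have term_le (K : hilbert R) n (T : tensor_power K n) (y : nat -> K) (B : R) k :
    (forall j, rnorm (y j) <= B) ->
    rnorm (b n k *: tensor T (fun i => y (k i))) <= Normc.normc (b n k) * B ^+ n.
  by move=> yB; rewrite rnormZ ler_wpM2l ?normc_ge0// rnorm_tensor_le.
pose sp n (N : nat) := \sum_(k : {ffun 'I_n -> 'I_N})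
  b n (fun i => k i) *: tensor (TE n p) (fun i => eap (k i)).
(* [tensor_series] is a [limn], so it is the limit of [sp n] as soon as [sp n] converges. *)
have cvg_sp n : sp n @ \oo --> tensor_series (TE n p) u eap (inN n (phi n)).
  pose Q := rnorm (phi n) ^+ 2 * C ^+ n.
  apply: (@box_series_cvg _ n _
    (fun k => b n k *: tensor (TE n p) (fun i => eap (k i)))
    (fun k => Normc.normc (b n k) * M ^+ n) ((Q + 1) * M ^+ n)) => [k|N].
    exact: term_le.
  rewrite -mulr_suml ler_wpM2r ?exprn_ge0 ?(ltW hM)//.
  (* From [x^2 <= Q] follows [x <= Q + 1], without a square root. *)
  have := b_sum n N; rewrite -/Q; set x := \sum_k _ => xQ.
  by nra.
pose y k := neg_scale_incl S p q%:R (eap k).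
pose rho := lam 0%N `^ (- (q%:R - p)).
have yM k : rnorm (y k) <= rho * M.
  apply: le_trans (neg_scale_incl_le hlam _ p0 pq) _.
  by rewrite ler_wpM2l ?powR_ge0.
pose psi n := neg_tensor_incl (TE n) p q%:R
  (tensor_series (TE n p) u eap (inN n (phi n))).
(* The inclusion is linear and continuous, so [psi n] is the same series formed with the vectors
   [y k], whose norms have gained the factor [rho]. *)
have cvg_psi n : (fun N => \sum_(k : {ffun 'I_n -> 'I_N})
    b n (fun i => k i) *: tensor (TE n q%:R) (fun i => y (k i))) @ \oo --> psi n.
  have [cI IE] := neg_tensor_inclP (TE n) p0 pq.
  suff E : (fun N => \sum_(k : {ffun 'I_n -> 'I_N})
      b n (fun i => k i) *: tensor (TE n q%:R) (fun i => y (k i))) =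
      neg_tensor_incl (TE n) p q%:R \o sp n.
    by rewrite E; exact: (continuous_cvg _ (cI _) (cvg_sp n)).
  apply/funext => N; rewrite /sp /= linear_sum; apply: eq_bigr => k _.
  by rewrite linearZ /= IE.
have psi_le n : rnorm (psi n) <= rnorm (phi n).
  apply: (rnorm_cvg_le (cvg_psi n)) => N.
  apply: le_trans (rnorm_sum _ _ _) _.
  apply: le_trans (ler_sum _ (fun k _ => term_le _ n _ _ (rho * M) _ yM)) _.
  rewrite -mulr_suml -ler_sqr ?nnegrE ?rnorm_ge0//; last first.
    rewrite mulr_ge0 ?exprn_ge0 ?mulr_ge0 ?powR_ge0 ?(ltW hM)//.
    by apply: sumr_ge0 => k _; exact: normc_ge0.
  rewrite exprMn; apply: le_trans (ler_wpM2r (sqr_ge0 _) (b_sum n N)) _.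
  (* The factors regroup as [(C M^2 rho^2)^n], at most 1 by the choice of [q]. *)
  rewrite -mulrA ler_piMr ?sqr_ge0// -exprM mulnC exprM -exprMn.
  apply: exprn_ile1; first exact: mulr_ge0 C0 (sqr_ge0 _).
  by rewrite (_ : C * _ = C * M ^+ 2 * rho ^+ 2) //; ring.
exists q, psi; split=> [|n m pm qm]; last by rewrite neg_tensor_incl_comp.
have [phi_sym phi_fin] := hphi; split=> [n|].
  apply: (symmetric_tensor_lim _ (cvg_psi n)) => s k.
  exact: (weighted_tensor_coef_perm (hinN n) uv).
apply: le_lt_trans phi_fin; apply: lee_nneseries => n _.
  by rewrite lee_fin mulr_ge0 ?exprn_ge0 ?rnorm_ge0.
by rewrite lee_fin ler_wpM2l// lerXn2r ?nnegrE ?rnorm_ge0.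
Qed.
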